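(* For a fixed set $\mathcal{A}$ of exact match anchors between strings $Q$ and $T$, the optimal colinear chaining cost under ChainX precedence $\prec_{\mathtt{ChainX}}$ equals the anchored edit distance and equals the optimal colinear chaining cost under strict precedence $\prec$ and under weak precedence $\prec_{\mathrm{w}}$.
   Context: Strings are 1-indexed; $[x..y]=\{x,\dots,y\}$. An exact match anchor between $Q$ and $T$ is a pair $([q_s..q_e],[t_s..t_e])$ with $1\le q_s\le q_e\le|Q|$, $1\le t_s\le t_e\le|T|$ and $Q[q_s..q_e]=T[t_s..t_e]$. For $a=([q_s..q_e],[t_s..t_e])$, $a'=([q_s'..q_e'],[t_s'..t_e'])$: strict precedence $a\prec a'$ if $q_s\le q_s'$, $q_e\le q_e'$, $t_s\le t_s'$, $t_e\le t_e'$ with at least one strict; weak precedence $a\prec_{\mathrm{w}}a'$ if $q_s\le q_s'$, $t_s\le t_s'$ with at least one strict; ChainX (strong) precedence $a\prec_{\mathtt{ChainX}}a'$ if $q_s<q_s'$, $q_e<q_e'$, $t_s<t_s'$, $t_e<t_e'$. $\mathrm{connect}(a,a')=\max(0,\,q_s'-q_e-1,\,t_s'-t_e-1)+|\max(0,q_e-q_s'+1)-\max(0,t_e-t_s'+1)|$. Under a precedence relation $R$, a colinear chain is a sequence $a_1,\dots,a_c$ of anchors from $\mathcal{A}$ with $a_i\,R\,a_{i+1}$ for all $i$, with cost $\sum_{i=0}^{c}\mathrm{connect}(a_i,a_{i+1})$ where $a_0=([0..0],[0..0])$ and $a_{c+1}=([|Q|+1..|Q|+1],[|T|+1..|T|+1])$;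 the optimal chaining cost is the minimum such cost. Anchored edit distance: a character match $Q[q_s+k]=T[t_s+k]$, $k\in[0..t_e-t_s]$, for some anchor of $\mathcal{A}$ is supported; the anchored edit distance is the minimum cost of an alignment of $Q$ and $T$ in which supported matches cost 0, unsupported matches cost 1, and insertions, deletions and substitutions cost 1. *)

(* Defs.v *)
From HB Require Import structures.
From mathcomp Require Import all_boot all_order all_algebra finmap.

Set Implicit Arguments.
Unset Strict Implicit.
Unset Printing Implicit Defensive.

(* Strings are sequences over an arbitrary alphabet; positions are 1-indexed.
   All costs are natural numbers. *)

Definition substring (X : Type) (s : seq X) (x y : nat) : seq X :=
  take (y.+1 - x) (drop x.-1 s).

(* The pair of intervals ([qs..qe], [ts..te]); the constraints that make it an
   exact match are in [exact_match], because the two sentinels of a chain are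
   of this shape without being exact matches. *)
Record anchor := Anchor { qs : nat; qe : nat; ts : nat; te : nat }.

Definition anchor_code (a : anchor) := (qs a, qe a, ts a, te a).
Definition anchor_decode (p : nat * nat * nat * nat) :=
  let: (a, b, c, d) := p in Anchor a b c d.
Lemma anchor_codeK : cancel anchor_code anchor_decode.
Proof. by case. Qed.
HB.instance Definition _ := Countable.copy anchor (can_type anchor_codeK).

Definition exact_match (X : eqType) (Q T : seq X) (a : anchor) : Prop :=
  [/\ 1 <= qs a <= qe a /\ qe a <= size Q,
      1 <= ts a <= te a /\ te a <= size T
    & substring Q (qs a) (qe a) = substring T (ts a) (te a)].

Definition strict_prec : rel anchor := fun a a' =>
  [&& qs a <= qs a', qe a <= qe a', ts a <= ts a', te a <= te a'
    & [|| qs a < qs a', qe a < qe a', ts a < ts a' | te a < te a']].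

Definition weak_prec : rel anchor := fun a a' =>
  [&& qs a <= qs a', ts a <= ts a' & (qs a < qs a') || (ts a < ts a')].

Definition chainx_prec : rel anchor := fun a a' =>
  [&& qs a < qs a', qe a < qe a', ts a < ts a' & te a < te a'].

(* Subtraction on nat is truncated, so that x - y is max(0, x - y); the outer
   `|_ - _| is the distance between two naturals. *)
Definition connect_cost (a a' : anchor) : nat :=
  maxn (qs a' - qe a - 1) (ts a' - te a - 1)
  + `|(qe a + 1 - qs a') - (te a + 1 - ts a')|.

Definition first_anchor : anchor := Anchor 0 0 0 0.
Definition last_anchor (n m : nat) : anchor := Anchor n.+1 n.+1 m.+1 m.+1.

(* [sorted R s] relates consecutive elements only. The empty chain (c = 0) is
   allowed. *)
Definition is_chain (R : rel anchor) (A : {fset anchor}) (s : seq anchor) :=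
  all (mem A) s && sorted R s.

(* [pairmap f x s] is [f x s_1; f s_1 s_2; ...]. *)
Definition chain_cost (n m : nat) (s : seq anchor) : nat :=
  sumn (pairmap connect_cost first_anchor (rcons s (last_anchor n m))).

Definition is_minimum (P : nat -> Prop) (d : nat) : Prop :=
  P d /\ forall d', P d' -> d <= d'.

Definition is_optimal_chaining_cost (R : rel anchor) (X : eqType)
    (Q T : seq X) (A : {fset anchor}) : nat -> Prop :=
  is_minimum (fun d => exists2 s,
    is_chain R A s & chain_cost (size Q) (size T) s = d).

(* An alignment is a sequence of columns: (Some x, Some y) is a match or a
   substitution, (Some x, None) a deletion, (None, Some y) an insertion; the
   column (None, None) is excluded. *)
Definition is_alignment (X : eqType) (Q T : seq X)
    (s : seq (option X * option X)) : Prop :=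
  [/\ pmap fst s = Q, pmap snd s = T & (None, None) \notin s].

Definition supported (A : {fset anchor}) (i j : nat) : bool :=
  has (fun a => has (fun k => (i == qs a + k) && (j == ts a + k))
                    (iota 0 (te a - ts a).+1)) A.

(* i and j are the positions in Q and T of the next character to be consumed. *)
Fixpoint alignment_cost_from (X : eqType) (A : {fset anchor}) (i j : nat)
    (s : seq (option X * option X)) : nat :=
  match s with
  | [::] => 0
  | (Some x, Some y) :: s' =>
      (if (x == y) && supported A i j then 0 else 1)
      + alignment_cost_from A i.+1 j.+1 s'
  | (Some _, None) :: s' => 1 + alignment_cost_from A i.+1 j s'
  | (None, Some _) :: s' => 1 + alignment_cost_from A i j.+1 s'
  | (None, None) :: s' => alignment_cost_from A i j s'
  end.

Definition alignment_cost (X : eqType) (A : {fset anchor})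
    (s : seq (option X * option X)) : nat := alignment_cost_from A 1 1 s.

Definition is_anchored_edit_distance (X : eqType) (Q T : seq X)
    (A : {fset anchor}) : nat -> Prop :=
  is_minimum (fun d => exists2 s,
    is_alignment Q T s & alignment_cost A s = d).

(* Main.v *)
(* The cost connect(a, a') is the largest of the two signed gaps between a and a'
   and of the distance between their diagonals. Hence, if a is followed by a' and
   does not precede it in the ChainX sense, one of the two can be dropped without
   increasing the cost, so any sequence of anchors whatsoever costs at least as
   much as some ChainX chain. The anchors supporting the matches of an alignment
   form a sequence that costs no more than the alignment. Conversely, a ChainX
   chain becomes an alignment of no larger cost by following each anchor as far as
   the start of the next one allows, and bridging the rest with substitutions and
   indels. *)
Require Import Defs.
From mathcomp Require Import all_boot all_order all_algebra finmap.
From mathcomp Require Import zify.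
From Stdlib Require Import Classical.

Set Implicit Arguments.
Unset Strict Implicit.
Unset Printing Implicit Defensive.

Lemma is_minimum_exists (P : nat -> Prop) (n : nat) :
  P n -> exists d, is_minimum P d.
Proof.
elim/ltn_ind: n => n IHn Pn.
case: (classic (exists2 m, m < n & P m)) => [[m ltmn Pm]|minn]; first exact: IHn Pm.
exists n; split=> // m Pm; rewrite leqNgt; apply/negP => ltmn.
by apply: minn; exists m.
Qed.

(** * Connection costs and the reduction to ChainX chains *)

(** If both gaps are nonnegative, the cost is the larger one; otherwise it is the distance between
    the diagonals. The additive form keeps later estimates linear despite truncated subtraction. *)
Lemma connect_cost_leP (a b : anchor) (c : nat) :
  reflect [/\ qs b <= qe a + 1 + c, ts b <= te a + 1 + c,
              ts b + qe a <= te a + qs b + c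
            & te a + qs b <= ts b + qe a + c]
          (connect_cost a b <= c).
Proof.
rewrite /connect_cost; apply: (iffP idP) => [H|[H1 H2 H3 H4]]; last by lia.
by split; lia.
Qed.

(** The start and the end of the anchor lie on the same diagonal. *)
Definition balanced (a : anchor) := te a + qs a == qe a + ts a.

(** Diagonal distances obey the triangle inequality. If [b] ends no later than [a] in one string,
    the gap to [c] there does not grow; in the other string it grows by at most the diagonal shift
    from [a] to [b]. *)
Lemma connect_cost_drop_second (a b c : anchor) :
  balanced b -> (qe b <= qe a) || (te b <= te a) ->
  connect_cost a c <= connect_cost a b + connect_cost b c.
Proof.
move=> /eqP balb leb.
have /connect_cost_leP[? ? ? ?] := leqnn (connect_cost a b).
have /connect_cost_leP[? ? ? ?] := leqnn (connect_cost b c).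
by apply/connect_cost_leP; split; lia.
Qed.

(** Mirror image of the previous lemma: reversing both strings exchanges starts and ends. *)
Lemma connect_cost_drop_first (p a b : anchor) :
  balanced a -> (qs b <= qs a) || (ts b <= ts a) ->
  connect_cost p b <= connect_cost p a + connect_cost a b.
Proof.
move=> /eqP bala leb.
have /connect_cost_leP[? ? ? ?] := leqnn (connect_cost p a).
have /connect_cost_leP[? ? ? ?] := leqnn (connect_cost a b).
by apply/connect_cost_leP; split; lia.
Qed.

Lemma chain_cost_cat (n m : nat) (s1 s2 : seq anchor) :
  chain_cost n m (s1 ++ s2) =
  sumn (pairmap connect_cost first_anchor s1)
  + sumn (pairmap connect_cost (last first_anchor s1)
            (rcons s2 (last_anchor n m))).
Proof. by rewrite /chain_cost rcons_cat pairmap_cat sumn_cat. Qed.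

Lemma not_sorted_split (T : Type) (R : rel T) (s : seq T) :
  ~~ sorted R s -> exists s1 a b s2, s = s1 ++ [:: a, b & s2] /\ ~~ R a b.
Proof.
elim: s => // a [|b s] //= IHs; case Rab: (R a b) => /= nRs; last first.
  by exists [::], a, b, s; rewrite Rab.
have [s1 [a' [b' [s2 [-> nR]]]]] := IHs nRs.
by exists (a :: s1), a', b', s2.
Qed.

Lemma chainx_chain_le (n m : nat) (s : seq anchor) :
  all balanced s ->
  exists s', [/\ {subset s' <= s}, sorted chainx_prec s'
               & chain_cost n m s' <= chain_cost n m s].
Proof.
have [k] := ubnP (size s); elim: k s => // k IHk s ltsk bals.
case srt: (sorted chainx_prec s); first by exists s; split.
have [s1 [a [b [s2 [def_s nRab]]]]] := not_sorted_split (negbT srt).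
rewrite {s srt}def_s in ltsk bals *.
(* It suffices to find a shorter subsequence that costs no more. *)
have {}IHk s : size s < size (s1 ++ [:: a, b & s2]) ->
    {subset s <= s1 ++ [:: a, b & s2]} ->
    chain_cost n m s <= chain_cost n m (s1 ++ [:: a, b & s2]) ->
    exists s', [/\ {subset s' <= s1 ++ [:: a, b & s2]}, sorted chainx_prec s'
               & chain_cost n m s' <= chain_cost n m (s1 ++ [:: a, b & s2])].
  move=> lts subs les.
  have [||s' [subs' srts' les']] := IHk s.
  - by apply: leq_trans lts _.
  - by apply/allP => x /subs; move/allP: bals; apply.
  by exists s'; split=> // [x /subs' /subs //|]; apply: leq_trans les' les.
have [bala balb] : balanced a /\ balanced b.
  by move: bals; rewrite all_cat /= => /and4P[].
(* If the ends violate the precedence, [b] is dropped; otherwise the starts do, and [a] is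
   dropped. *)
have [leb|gtb] := boolP ((qe b <= qe a) || (te b <= te a)).
  apply: (IHk (s1 ++ a :: s2)).
  - by rewrite !size_cat /= ltn_add2l.
  - by move=> x; rewrite !mem_cat !inE => /or3P[] ->; rewrite ?orbT.
  rewrite !chain_cost_cat /= leq_add2l leq_add2l.
  case: s2 {ltsk bals IHk} => [|c s2] /=; rewrite addnA leq_add2r;
  exact: connect_cost_drop_second.
apply: (IHk (s1 ++ b :: s2)).
- by rewrite !size_cat /= ltn_add2l.
- by move=> x; rewrite !mem_cat !inE => /or3P[] ->; rewrite ?orbT.
rewrite !chain_cost_cat /= leq_add2l addnA leq_add2r.
by apply: connect_cost_drop_first => //; move: nRab gtb; rewrite /chainx_prec; lia.
Qed.

(** * From alignments to sequences of anchors *)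

Lemma supportedP (A : {fset anchor}) (i j : nat) :
  reflect (exists2 a, a \in A
             & exists2 k, k <= te a - ts a & i = qs a + k /\ j = ts a + k)
          (supported A i j).
Proof.
apply: (iffP hasP) => [[a Aa /hasP[k]]|[a Aa [k lek [-> ->]]]].
  rewrite mem_iota => lek /andP[/eqP -> /eqP ->]; exists a => //.
  by exists k; lia.
by exists a => //; apply/hasP; exists k; rewrite ?mem_iota ?eqxx //; lia.
Qed.

Lemma exact_match_balanced (X : eqType) (Q T : seq X) (a : anchor) :
  exact_match Q T a -> balanced a.
Proof.
case=> [[/andP[? ?] ?] [/andP[? ?] ?]] /(congr1 size).
rewrite /substring !size_take_min !size_drop /balanced.
by lia.
Qed.

(** Here [p] is the last anchor chosen and [c] the cost paid since. The four inequalities say that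
    connecting [p] to an anchor starting at [(i, j)] costs at most [c]. The sequence [w] may repeat
    anchors; it is pruned later. *)
Lemma chain_of_alignment_from (X : eqType) (A : {fset anchor}) (n m : nat)
    (s : seq (option X * option X)) (p : anchor) (i j c : nat) :
  (forall a, a \in A -> balanced a /\ ts a <= te a) ->
  i <= qe p + 1 + c -> j <= te p + 1 + c ->
  j + qe p <= te p + i + c -> te p + i <= j + qe p + c ->
  i + size (pmap fst s) = n.+1 -> j + size (pmap snd s) = m.+1 ->
  (None, None) \notin s ->
  exists2 w, {subset w <= A}
    & sumn (pairmap connect_cost p (rcons w (last_anchor n m)))
      <= c + alignment_cost_from A i j s.
Proof.
move=> hA.
elim: s p i j c => [|[[x|] [y|]] s IHs] p i j c lei lej leD geD /=;
  rewrite ?inE //=.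
- move=> defn defm _; exists [::] => //=; rewrite !addn0.
  by apply/connect_cost_leP; split=> /=; lia.
- move=> defn defm nNs; have [/andP[_ /supportedP[a Aa [k lek [di dj]]]]|_] := ifP.
    have [/eqP bala leta] := hA a Aa.
    (* The next position is on the diagonal of [a] and at most one past its end, so the cost
       restarts at 0. *)
    have [|||||||w subw lew] := IHs a i.+1 j.+1 0; try lia; first exact: nNs.
    exists (a :: w) => [z|/=]; first by rewrite inE => /orP[/eqP -> //|/subw].
    rewrite !add0n in lew *; apply: leq_add lew.
    by apply/connect_cost_leP; split; lia.
  have [|||||||w subw lew] := IHs p i.+1 j.+1 c.+1; try lia; first exact: nNs.
  by exists w => //; rewrite addnA addn1.
- move=> defn defm nNs.
  have [|||||||w subw lew] := IHs p i.+1 j c.+1; try lia; first exact: nNs.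
  by exists w => //; rewrite addnA addn1.
- move=> defn defm nNs.
  have [|||||||w subw lew] := IHs p i j.+1 c.+1; try lia; first exact: nNs.
  by exists w => //; rewrite addnA addn1.
Qed.

(** * From ChainX chains to alignments *)

(* The suffixes of Q and T that remain after i and j characters; the offsets i
   and j are 0-based, whereas positions in an anchor are 1-based. *)
Definition alignable (X : eqType) (Q T : seq X) (A : {fset anchor})
    (i j c : nat) : Prop :=
  exists2 s, [/\ pmap fst s = drop i Q, pmap snd s = drop j T
                & (None, None) \notin s]
           & alignment_cost_from A i.+1 j.+1 s <= c.

Lemma drop_cons (T : Type) (s : seq T) (i : nat) :
  i < size s -> exists x, drop i s = x :: drop i.+1 s.
Proof. by case: s => // x s lti; exists (nth x (x :: s) i); exact: drop_nth. Qed.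

Section Alignable.

Context (X : eqType) (Q T : seq X) (A : {fset anchor}).

(** Diagonal columns are used while both strings have characters left, then indels. The number of
    columns is the longer side, and each costs at most 1. *)
Lemma alignable_gap (i j i' j' c d : nat) :
  alignable Q T A i' j' c -> i <= i' <= size Q -> j <= j' <= size T ->
  i' - i <= d -> j' - j <= d -> alignable Q T A i j (c + d).
Proof.
move=> al'; elim: d i j => [|d IHd] i j /andP[lei leQ] /andP[lej leT] ledi ledj.
  by rewrite addn0 (_ : i = i') 1?(_ : j = j') //; lia.
have [lti|gei] := ltnP i i'; have [ltj|gej] := ltnP j j'.
- have [||||s [sQ sT nN] les] := IHd i.+1 j.+1; try lia.
  have [x dx] : exists x, drop i Q = x :: drop i.+1 Q by apply: drop_cons; lia.
  have [y dy] : exists y, drop j T = y :: drop j.+1 T by apply: drop_cons; lia.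
  exists ((Some x, Some y) :: s); first by rewrite /= sQ sT dx dy inE.
  by move=> /=; case: ifP => _; lia.
- have [||||s [sQ sT nN] les] := IHd i.+1 j; try lia.
  have [x dx] : exists x, drop i Q = x :: drop i.+1 Q by apply: drop_cons; lia.
  exists ((Some x, None) :: s); first by rewrite /= sQ sT dx inE.
  by move=> /=; lia.
- have [||||s [sQ sT nN] les] := IHd i j.+1; try lia.
  have [y dy] : exists y, drop j T = y :: drop j.+1 T by apply: drop_cons; lia.
  exists ((None, Some y) :: s); first by rewrite /= sQ sT dy inE.
  by move=> /=; lia.
- have [||||s al les] := IHd i j; try lia.
  by exists s => //; lia.
Qed.

Lemma exact_match_drop (a : anchor) (k : nat) :
  exact_match Q T a -> k <= te a - ts a ->
  exists x, drop ((qs a).-1 + k) Q = x :: drop ((qs a).-1 + k).+1 Q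
         /\ drop ((ts a).-1 + k) T = x :: drop ((ts a).-1 + k).+1 T.
Proof.
move=> ema lek; have /eqP bala := exact_match_balanced ema.
case: ema => [[/andP[? ?] ?] [/andP[? ?] ?]].
(* This reads off the character at offset [k]; the lengths are then split so that a nonempty prefix
   remains after the drop. *)
move=> /(congr1 (fun s => ohead (drop k s))); rewrite /substring.
have -> : (qe a).+1 - qs a = (qe a - qs a - k).+1 + k by lia.
have -> : (te a).+1 - ts a = (te a - ts a - k).+1 + k by lia.
rewrite -!take_drop !drop_drop ![k + _]addnC.
have [x ->] : exists x, drop ((qs a).-1 + k) Q = x :: drop ((qs a).-1 + k).+1 Q.
  by apply: drop_cons; lia.
have [y ->] : exists y, drop ((ts a).-1 + k) T = y :: drop ((ts a).-1 + k).+1 T.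
  by apply: drop_cons; lia.
by move=> /= [->]; exists y.
Qed.

Lemma alignable_anchor (a : anchor) (k c : nat) :
  a \in A -> exact_match Q T a -> k <= (te a).+1 - ts a ->
  alignable Q T A ((qs a).-1 + k) ((ts a).-1 + k) c ->
  alignable Q T A (qs a).-1 (ts a).-1 c.
Proof.
move=> Aa ema; elim: k => [|k IHk] lek; first by rewrite !addn0.
rewrite !addnS => -[s [sQ sT nN] les]; apply: IHk; first by lia.
have [|x [dQ dT]] := exact_match_drop (k := k) ema; first by lia.
exists ((Some x, Some x) :: s); first by rewrite /= sQ sT dQ dT inE.
rewrite /= eqxx /=; case: supportedP => // -[]; exists a => //.
by case: ema => [[/andP[? ?] ?] [/andP[? ?] ?]] _; exists k; lia.
Qed.

Lemma alignable_connect (a b : anchor) (c : nat) :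
  a \in A -> exact_match Q T a ->
  qs a <= qs b <= (size Q).+1 -> ts a <= ts b <= (size T).+1 ->
  alignable Q T A (qs b).-1 (ts b).-1 c ->
  alignable Q T A (qs a).-1 (ts a).-1 (connect_cost a b + c).
Proof.
move=> Aa ema leq_q leq_t alb; have /eqP bala := exact_match_balanced ema.
have [[/andP[? ?] ?] [/andP[? ?] ?] _] := ema.
(* Follow [a] until it ends or [b] starts in either string. The sides left are the two gaps in the
   first case, and 0 and the diagonal distance in the second. *)
pose k := minn ((te a).+1 - ts a) (minn (qs b - qs a) (ts b - ts a)).
apply: (@alignable_anchor a k) => //; first by lia.
have /connect_cost_leP[? ? ? ?] := leqnn (connect_cost a b).
by rewrite [_ + c]addnC; apply: (alignable_gap alb); rewrite {}/k; lia.
Qed.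

Context (hA : forall a, a \in A -> exact_match Q T a).

Lemma alignable_chain (p : anchor) (s : seq anchor) :
  {subset p :: s <= A} -> path chainx_prec p s ->
  alignable Q T A (qs p).-1 (ts p).-1
    (sumn (pairmap connect_cost p (rcons s (last_anchor (size Q) (size T))))).
Proof.
elim: s p => [|a s IHs] p subA /=.
  have Ap : p \in A by apply: subA; rewrite inE.
  have emp := hA Ap; have [[/andP[? ?] ?] [/andP[? ?] ?] _] := emp.
  move=> _; apply: (alignable_connect Ap emp) => /=; try lia.
  by exists [::]; rewrite ?drop_size.
case/andP=> /and4P[? ? ? ?] srt.
have [Ap Aa] : p \in A /\ a \in A by split; apply: subA; rewrite !inE eqxx ?orbT.
have [[/andP[? ?] ?] [/andP[? ?] ?] _] := hA Aa.
apply: (alignable_connect Ap (hA Ap)); try lia.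
by apply: IHs => // x xs; apply: subA; rewrite inE xs orbT.
Qed.

Lemma alignment_of_chain (s : seq anchor) :
  is_chain chainx_prec A s ->
  exists2 w, is_alignment Q T w
    & alignment_cost A w <= chain_cost (size Q) (size T) s.
Proof.
case/andP=> /allP subA srt.
suff [w [wQ wT nN] lew] : alignable Q T A 0 0 (chain_cost (size Q) (size T) s).
  by exists w; rewrite // /is_alignment wQ wT !drop0.
rewrite /chain_cost; case: s subA srt => [|a s] subA srt /=; last first.
  have [[/andP[? ?] ?] [/andP[? ?] ?] _] : exact_match Q T a.
    by apply/hA/subA; rewrite inE eqxx.
  (* The initial sentinel has no characters to follow: its connection is a pure gap. *)
  rewrite addnC; apply: alignable_gap (alignable_chain subA srt) _ _ _ _;
    by rewrite /connect_cost /=; lia.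
rewrite addn0 -[connect_cost _ _]add0n.
apply: (@alignable_gap _ _ (size Q) (size T)); rewrite /connect_cost /=; try lia.
by exists [::]; rewrite ?drop_size.
Qed.

(** * Comparison of the optimal costs *)

Lemma chainx_chain_of_seq (s : seq anchor) :
  {subset s <= A} ->
  exists2 s', is_chain chainx_prec A s'
    & chain_cost (size Q) (size T) s' <= chain_cost (size Q) (size T) s.
Proof.
move=> subA; have [|s' [subs' srt les']] := @chainx_chain_le (size Q) (size T) s.
  by apply/allP => a /subA /hA /exact_match_balanced.
by exists s'; rewrite // /is_chain srt andbT; apply/allP => a /subs' /subA.
Qed.

Lemma chainx_chain_of_alignment (w : seq (option X * option X)) :
  is_alignment Q T w ->
  exists2 s, is_chain chainx_prec A s
    & chain_cost (size Q) (size T) s <= alignment_cost A w.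
Proof.
case=> wQ wT nN.
(* The initial sentinel ends at 0, so position 1 follows it directly, with nothing paid yet. *)
have [||||||||s subA les] := @chain_of_alignment_from X A (size Q) (size T) w first_anchor 1 1 0.
- move=> a /hA ema; split; first exact: exact_match_balanced ema.
  by have [_ [/andP[]]] := ema.
- by [].
- by [].
- by [].
- by [].
- by rewrite wQ add1n.
- by rewrite wT add1n.
- exact: nN.
have [s' chs' les'] := chainx_chain_of_seq subA.
by exists s' => //; apply: leq_trans les' les.
Qed.

(** A larger relation admits more chains, but each of them reduces to a ChainX chain of no larger
    cost. *)
Lemma optimal_chaining_cost_superrel (R : rel anchor) (d : nat) :
  subrel chainx_prec R ->
  is_optimal_chaining_cost chainx_prec Q T A d ->
  is_optimal_chaining_cost R Q T A d.
Proof.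
move=> subR [[s /andP[sA srt] <-] mind]; split.
  by exists s; rewrite // /is_chain sA; apply: sub_sorted srt.
move=> _ [s' /andP[/allP s'A _] <-].
have [s2 ch2 le2] := chainx_chain_of_seq s'A.
by apply: leq_trans le2; apply: mind; exists s2.
Qed.

End Alignable.

Theorem theorem3 (X : eqType) (Q T : seq X) (A : {fset anchor})
    (hA : forall a, a \in A -> exact_match Q T a) :
  exists d : nat,
    [/\ is_optimal_chaining_cost chainx_prec Q T A d,
        is_anchored_edit_distance Q T A d,
        is_optimal_chaining_cost strict_prec Q T A d
      & is_optimal_chaining_cost weak_prec Q T A d].
Proof.
have [|d optd] := @is_minimum_exists
  (fun d => exists2 s, is_chain chainx_prec A s & chain_cost (size Q) (size T) s = d)
  (chain_cost (size Q) (size T) [::]); first by exists [::].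
exists d; split=> //.
- have [[s chs <-] mind] := optd.
  have lb w : is_alignment Q T w ->
      chain_cost (size Q) (size T) s <= alignment_cost A w.
    case/(chainx_chain_of_alignment hA) => s' chs'; apply: leq_trans.
    by apply: mind; exists s'.
  split=> [|_ [w alw <-]]; last exact: lb.
  have [w alw lew] := alignment_of_chain hA chs.
  (* The alignment built from an optimal chain attains the lower bound [lb]. *)
  by exists w => //; apply/eqP; rewrite eqn_leq lew lb.
- apply: optimal_chaining_cost_superrel optd => // a b.
  by rewrite /chainx_prec /strict_prec; lia.
- apply: optimal_chaining_cost_superrel optd => // a b.
  by rewrite /chainx_prec /weak_prec; lia.
Qed.
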